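(* Let $g_0,\xi^0_0,\xi^1_0,(g_k,\xi^0_k,\xi^1_k,\check\mu^0_k,\mu^1_k)_{k=1}^N$, with associated momenta $(\mu^0_k)_{k=0}^N$ and $\mu_0^1$, be a solution of the discrete Euler--Lagrange equations (D1)--(D7) (listed in the context) of the discrete second-order inexact trajectory planning problem with node indices $0=N_0<N_1<\cdots<N_l=N$. Then for $k=0,\ldots,N$, $$\langle\mu^0_k,\rho\rangle=0\qquad\text{for all }\rho\in\mathfrak g_{g_kQ_0},$$ where, for $q\in Q$, $\mathfrak g_q$ denotes the Lie algebra of the isotropy subgroup $G_q=\{a\in G : aq=q\}$.
   Context: Setting. $G$ is a finite-dimensional Lie group with Lie algebra $\mathfrak g$ and identity $e$, acting smoothly from the left on a finite-dimensional manifold $Q$. $d:Q\times Q\to\mathbb R$ is a distance function. $Q_0,Q_{t_1},\ldots,Q_{t_l}\in Q$ are given points, $\sigma>0$, $h>0$ is a step size, $N\ge1$, and $0=N_0<N_1<\cdots<N_l=N$ are integers (node indices $N_1,\ldots,N_l$). $\ell:\mathfrak g\times\mathfrak g\to\mathbb R$ is a smooth function; $\frac{\delta\ell}{\delta\xi^0_k},\frac{\delta\ell}{\delta\xi^1_k}\in\mathfrak g^*$ denote its partial derivatives in the first and second argument at $(\xi^0_k,\xi^1_k)$. $\langle\cdot,\cdot\rangle$ denotes duality pairings; a superscript $*$ on a linear map denotes its dual. The map $\tau:\mathfrak g\to G$ approximates the Lie exponential: it is an analytic diffeomorphism from a neighbourhood of $0$ onto its image, $\tau(0)=e$, and $\tau(\xi)\tau(-\xi)=e$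 for all $\xi\in\mathfrak g$. Its left-trivialized differential at $\xi$ is $D\tau_\xi:\mathfrak g\to\mathfrak g$, $\eta\mapsto\tau(\xi)^{-1}(T_\xi\tau(\eta))$ (left translation by $\tau(\xi)^{-1}$), with inverse $D\tau_\xi^{-1}:=(D\tau_\xi)^{-1}$. It is assumed that $\pm h\xi^0_k$ ($k=0,\ldots,N-1$) lie in the neighbourhood on which $\tau$ is a diffeomorphism, so that these inverses exist. Notation. For $\xi\in\mathfrak g$, $q\in Q$: $\xi_Q(q)=\frac{d}{d\varepsilon}\big|_{\varepsilon=0}\exp(\varepsilon\xi)q$. The cotangent lift momentum map $J^Q:T^*Q\to\mathfrak g^*$ is defined by $\langle J^Q(\alpha_q),\xi\rangle=\langle\alpha_q,\xi_Q(q)\rangle$. $\mathrm{d}_1d(q_1,q_2)\in T^*_{q_1}Q$ is the differential of $d$ in its first argument. $d_{N_i}:=d(g_{N_i}Q_0,Q_{t_i})$, $\mathrm{d}_1d_{N_i}:=\mathrm{d}_1d(g_{N_i}Q_0,Q_{t_i})$; $d$ is assumed differentiable in its first argument at these points (if $d_{N_i}=0$, the product $d_{N_i}\,\mathrm{d}_1d_{N_i}$ is read as the differential of $\tfrac12d^2$ in the first argument). Discrete paths: $g_k\in G$, $\xi^0_k,\xi^1_k\in\mathfrak g$ for $k=0,\ldots,N$, and $\check\mu^0_k,\mu^1_k\in\mathfrak g^*$ for $k=1,\ldots,N$, with $g_0=e$ and $\xi^0_0$ prescribed. Define $$\mu^1_0:=\mu^1_1+h\check\mu^0_1-h\frac{\delta\ell}{\delta\xi^0_0},\qquad\mu^0_0:=(D\tau^{-1}_{h\xi^0_0})^*\check\mu^0_1,\qquad\mu^0_k:=(D\tau^{-1}_{-h\xi^0_{k-1}})^*\check\mu^0_k\quad(k=1,\ldots,N).$$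 The discrete Euler--Lagrange equations are: (D1) $g_{k+1}=\tau(h\xi^0_k)g_k$ with $\tau^{-1}(g_{k+1}g_k^{-1})=h\xi_k^0$, and $\xi^0_{k+1}=\xi^0_k+h\xi^1_k$, $k=0,\ldots,N-1$; (D2) $\mu^1_{k+1}=\mu^1_k-h(D\tau_{-h\xi^0_k})^*\mu^0_{k+1}+h\frac{\delta\ell}{\delta\xi^0_k}$, $k=1,\ldots,N-1$; (D3) $\frac{\delta\ell}{\delta\xi^1_k}-\mu^1_{k+1}=0$, $k=0,\ldots,N-1$; (D4) $\mu^0_{k+1}=(D\tau^{-1}_{-h\xi^0_k})^*(D\tau_{h\xi^0_k})^*\mu^0_k$ for $k\in\{0,\ldots,N-1\}\setminus\{N_1,\ldots,N_l\}$ (for $k=0$ this holds by the definitions of $\mu^0_0$ and $\mu^0_1$); (D5) $\mu^0_{k+1}=(D\tau^{-1}_{-h\xi^0_k})^*(D\tau_{h\xi^0_k})^*\left(\mu^0_k+\frac{d_k}{\sigma^2}J^Q(\mathrm{d}_1d_k)\right)$ for $k=N_i$, $i=1,\ldots,l-1$; (D6) $\mu^0_N+\frac{d_N}{\sigma^2}J^Q(\mathrm{d}_1d_N)=0$; (D7) $\mu^1_N=0$. *)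

(* Defs.v *)
(* MathComp-Analysis.  The libraries contain no differential geometry, so
   the part of it that is needed is set up here.  A tangent space [T_p M] of an
   n-dimensional manifold is represented by ['rV[R]_n], read in the preferred
   chart [chart_at p]; in particular the Lie algebra of an m-dimensional Lie
   group is ['rV[R]_m], read in [chart_at 1]. *)
From HB Require Import structures.
From mathcomp Require Import all_boot all_order all_algebra.
From mathcomp Require Import all_classical all_reals all_analysis.
Set Implicit Arguments.
Unset Strict Implicit.
Unset Printing Implicit Defensive.
Import Order.TTheory GRing.Theory Num.Theory numFieldNormedType.Exports.
Local Open Scope classical_set_scope.
Local Open Scope ring_scope.

#[short(type="topGroupType")]
HB.structure Definition TopGroup := {G of Group G & Topological G}.

Section Regularity.
Context {R : realType}.

(* [f] is of class C^k on the open set [U]. *)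
Fixpoint Ck_on (k : nat) {V W : normedModType R} (U : set V) (f : V -> W) : Prop :=
  if k is k'.+1 then
    (forall x, U x -> differentiable f x) /\
    (forall v, Ck_on k' U (fun x => 'D_v f x))
  else forall x, U x -> {for x, continuous f}.

Definition smooth_on {V W : normedModType R} (U : set V) (f : V -> W) : Prop :=
  forall k, Ck_on k U f.

(* The k-th term is the homogeneous part of degree k of the Taylor series:
   [D_v^k f x / k! = \sum_(|a| = k) (d^a f x / a!) v^a]. *)
Definition analytic_on {V W : normedModType R} (U : set V) (f : V -> W) : Prop :=
  smooth_on U f /\
  forall x, U x -> exists2 r : R, 0 < r &
    forall v, `|v| < r ->
      series (fun k => (k`!%:R)^-1 *: iter k (fun g y => 'D_v g y) f x) @ \oo
        --> f (x + v).

Inductive regularity := Smooth | Analytic.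

Definition class_on (r : regularity) {V W : normedModType R}
    (U : set V) (f : V -> W) : Prop :=
  match r with Smooth => smooth_on U f | Analytic => analytic_on U f end.

End Regularity.

Section Manifolds.
Context {R : realType}.

Record chart (M : topologicalType) (E : normedModType R) := Chart {
  chart_dom : set M;
  chart_fun :> M -> E;
  chart_inv : E -> M }.

Record is_chart {M : topologicalType} {E : normedModType R}
    (c : chart M E) : Prop := {
  chart_open_dom : open (chart_dom c);
  chart_open_im : open (c @` chart_dom c);
  chartK : forall x, chart_dom c x -> chart_inv c (c x) = x;
  chart_cont : forall x, chart_dom c x -> {for x, continuous c};
  chart_inv_cont : forall x, chart_dom c x -> {for c x, continuous (chart_inv c)} }.

Definition id_chart (E : normedModType R) : chart E E := Chart setT id id.

Definition prod_chart {M N : topologicalType} {E F : normedModType R}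
    (c : chart M E) (c' : chart N F) : chart (M * N)%type (E * F)%type :=
  Chart [set p | chart_dom c p.1 /\ chart_dom c' p.2]
        (fun p => (c p.1, c' p.2))
        (fun v => (chart_inv c v.1, chart_inv c' v.2)).

Definition prod_atlas {M N : topologicalType} {E F : normedModType R}
    (A : set (chart M E)) (B : set (chart N F)) :
    set (chart (M * N)%type (E * F)%type) :=
  [set e | exists2 c, A c & exists2 c', B c' & e = prod_chart c c'].

(* [A] is an atlas of class [r] on [M]. *)
Record is_atlas (r : regularity) {M : topologicalType} {E : normedModType R}
    (A : set (chart M E)) : Prop := {
  atlas_cover : forall x, exists2 c, A c & chart_dom c x;
  atlas_chart : forall c, A c -> is_chart c;
  atlas_transition : forall c c', A c -> A c' ->
    class_on r (c @` (chart_dom c `&` chart_dom c')) (c' \o chart_inv c) }.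

(* [F] is a map of class [r] on the open set [D], with respect to the atlases
   [A] and [B]. *)
Definition mfd_map (r : regularity) {M N : topologicalType}
    {E E' : normedModType R} (A : set (chart M E)) (B : set (chart N E'))
    (D : set M) (F : M -> N) : Prop :=
  (forall x, D x -> {for x, continuous F}) /\
  (forall c c', A c -> B c' ->
     class_on r (c @` (chart_dom c `&` D `&` F @^-1` chart_dom c'))
                (c' \o F \o chart_inv c)).

Record manifold (n : nat) (M : topologicalType) := Manifold {
  atlas : set (chart M 'rV[R]_n);
  atlasP : is_atlas Smooth atlas;
  chart_at : M -> chart M 'rV[R]_n;
  chart_at_atlas : forall p, atlas (chart_at p);
  mem_chart_at : forall p, chart_dom (chart_at p) p;
  mfd_hausdorff : hausdorff_space M;
  mfd_second_countable : @second_countable M }.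

(* The tangent map [T_p F], read in the charts [c] at [p] and [c'] at [F p]. *)
Definition tangent_map {M N : topologicalType} {E E' : normedModType R}
    (c : chart M E) (c' : chart N E') (F : M -> N) (p : M) : E -> E' :=
  'd (c' \o F \o chart_inv c) (c p).

Definition differentiable_at {n : nat} {M : topologicalType}
    (X : manifold n M) (f : M -> R^o) (p : M) : Prop :=
  differentiable (f \o chart_inv (chart_at X p)) (chart_at X p p).

(* The differential of [f] at [p], as an element of [T_p^* M]. *)
Definition differential {n : nat} {M : topologicalType}
    (X : manifold n M) (f : M -> R^o) (p : M) : 'Hom('rV[R]_n, R^o) :=
  linfun (tangent_map (chart_at X p) (id_chart R^o) f p).

Definition is_distance {M : Type} (d : M -> M -> R) : Prop :=
  [/\ forall x y, 0 <= d x y,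
      forall x y, d x y = 0 <-> x = y,
      forall x y, d x y = d y x &
      forall x y z, d x z <= d x y + d y z].

End Manifolds.

Section LieGroups.
Context {R : realType}.

(* [A] is an atlas of class [r] for which the group operations are of class [r]. *)
Definition lie_atlas (r : regularity) {m : nat} {G : topGroupType}
    (A : set (chart G 'rV[R]_m)) : Prop :=
  [/\ is_atlas r A,
      mfd_map r (prod_atlas A A) A setT (fun p : G * G => (p.1 * p.2)%g) &
      mfd_map r A A setT (fun a : G => (a^-1)%g)].

Record lie_group (m : nat) (G : topGroupType) := LieGroup {
  lie_manifold :> manifold m G;
  lie_group_atlas : lie_atlas Smooth (atlas lie_manifold) }.

Definition one_parameter_subgroup {m : nat} {G : topGroupType}
    (L : lie_group m G) (xi : 'rV[R]_m) (c : R^o -> G) : Prop :=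
  [/\ forall s t, c (s + t) = (c s * c t)%g,
      mfd_map Smooth [set id_chart R^o] (atlas L) setT c &
      'D_1 (chart_at L 1%g \o c) 0 = xi].

(* The Lie exponential: the value at time 1 of the one-parameter subgroup with
   initial velocity [xi], which exists and is unique; the default value [1%g] is
   never used. *)
Definition lie_exp {m : nat} {G : topGroupType} (L : lie_group m G)
    (xi : 'rV[R]_m) : G :=
  xget 1%g [set a | exists2 c, one_parameter_subgroup L xi c & c 1 = a].

(* The Lie algebra of a closed subgroup [H] of [G]. *)
Definition lie_algebra {m : nat} {G : topGroupType} (L : lie_group m G)
    (H : set G) : set 'rV[R]_m :=
  [set xi | forall t : R, H (lie_exp L (t *: xi))].

(* Every Lie group has exactly one analytic atlas that is compatible with its
   smooth structure and has analytic group operations: this is the atlas [A]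
   with respect to which [tau] is an analytic diffeomorphism from [U] onto
   [tau @` U]. *)
Definition analytic_diffeo {m : nat} {G : topGroupType} (L : lie_group m G)
    (U : set 'rV[R]_m) (tau : 'rV[R]_m -> G) : Prop :=
  [/\ open U, open (tau @` U), {in U &, injective tau} &
      exists A : set (chart G 'rV[R]_m),
        [/\ lie_atlas Analytic A, is_atlas Smooth (A `|` atlas L),
            mfd_map Analytic [set id_chart 'rV[R]_m] A U tau &
            mfd_map Analytic A [set id_chart 'rV[R]_m] (tau @` U)
              ('pinv_(fun=> 0) U tau)]].

(* The left-trivialized differential of [tau] at [xi]. *)
Definition Dtau {m : nat} {G : topGroupType} (L : lie_group m G)
    (tau : 'rV[R]_m -> G) (xi : 'rV[R]_m) : 'End('rV[R]_m) :=
  linfun (tangent_map (chart_at L (tau xi)) (chart_at L 1%g)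
            (fun a : G => ((tau xi)^-1 * a)%g) (tau xi)
          \o tangent_map (id_chart 'rV[R]_m) (chart_at L (tau xi)) tau xi).

Definition Dtau_inv {m : nat} {G : topGroupType} (L : lie_group m G)
    (tau : 'rV[R]_m -> G) (xi : 'rV[R]_m) : 'End('rV[R]_m) :=
  ((Dtau L tau xi)^-1)%VF.

(* The dual [A^* : g^* -> g^*] of a linear map [A : g -> g]. *)
Definition dual {m : nat} (A : 'End('rV[R]_m)) (mu : 'Hom('rV[R]_m, R^o)) :
    'Hom('rV[R]_m, R^o) := (mu \o A)%VF.

(* A smooth left action of [G] on [Q]. *)
Record smooth_action {m n : nat} {G : topGroupType} {Q : topologicalType}
    (L : lie_group m G) (X : manifold (R := R) n Q) (act : G -> Q -> Q) : Prop := {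
  act1 : forall q, act 1%g q = q;
  actM : forall a b q, act (a * b)%g q = act a (act b q);
  act_smooth : mfd_map Smooth (prod_atlas (atlas L) (atlas X)) (atlas X) setT
                 (fun p : G * Q => act p.1 p.2) }.

Definition isotropy {G : topGroupType} {Q : topologicalType}
    (act : G -> Q -> Q) (q : Q) : set G := [set a | act a q = q].

Definition inf_generator {m n : nat} {G : topGroupType} {Q : topologicalType}
    (L : lie_group m G) (X : manifold n Q) (act : G -> Q -> Q)
    (xi : 'rV[R]_m) (q : Q) : 'rV[R]_n :=
  'D_1 (fun eps : R^o => chart_at X q (act (lie_exp L (eps *: xi)) q)) 0.

(* [<J^Q(alpha_q), xi>] as a function of [xi]. *)
Definition momentum_map {m n : nat} {G : topGroupType} {Q : topologicalType}
    (L : lie_group m G) (X : manifold n Q) (act : G -> Q -> Q)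
    (q : Q) (alpha : 'Hom('rV[R]_n, R^o)) (xi : 'rV[R]_m) : R :=
  alpha (inf_generator L X act xi q).

End LieGroups.

Section DiscreteEulerLagrange.
Context {R : realType} {m n : nat} {G : topGroupType} {Q : topologicalType}.
Context (L : lie_group (R := R) m G) (X : manifold (R := R) n Q).
Context (act : G -> Q -> Q) (d : Q -> Q -> R).

(* [d] is differentiable in its first argument at [q], with [y] as second
   argument; at [d q y = 0] this is required of [d^2 / 2] instead. *)
Definition diff1_dist (q y : Q) : Prop :=
  if d q y == 0 then differentiable_at X (fun x => 2^-1 * d x y ^+ 2) q
  else differentiable_at X (fun x => d x y) q.

(* [d / sigma^2 <J^Q(d_1 d), xi>] at [(q, y)], where [d d_1 d] stands for the
   differential of [d^2 / 2] if [d q y = 0]. *)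
Definition node_force (sigma : R) (q y : Q) (xi : 'rV[R]_m) : R :=
  if d q y == 0 then
    (sigma ^+ 2)^-1
      * momentum_map L X act q (differential X (fun x => 2^-1 * d x y ^+ 2) q) xi
  else
    d q y / sigma ^+ 2
      * momentum_map L X act q (differential X (fun x => d x y) q) xi.

Definition dl_xi0 (l : 'rV[R]_m * 'rV[R]_m -> R^o) (a b : 'rV[R]_m) :
    'Hom('rV[R]_m, R^o) := linfun ('d (fun x => l (x, b)) a).

Definition dl_xi1 (l : 'rV[R]_m * 'rV[R]_m -> R^o) (a b : 'rV[R]_m) :
    'Hom('rV[R]_m, R^o) := linfun ('d (fun x => l (a, x)) b).

(* Only the indices [k <= N] matter, and [1 <= k <= N] for [muc].  The number of
   target points is [p], the node indices are [nd 1 < ... < nd p], and [nd 0 = 0]. *)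
Record discrete_EL (tau : 'rV[R]_m -> G) (U : set 'rV[R]_m)
    (l : 'rV[R]_m * 'rV[R]_m -> R^o) (sigma h : R) (N p : nat) (nd : nat -> nat)
    (Q0 : Q) (Qt : nat -> Q) (xi00 : 'rV[R]_m)
    (g : nat -> G) (xi0 xi1 : nat -> 'rV[R]_m)
    (muc mu0 mu1 : nat -> 'Hom('rV[R]_m, R^o)) : Prop := {
  EL_g0 : g 0%N = 1%g;
  EL_xi00 : xi0 0%N = xi00;
  EL_mu1_0 : mu1 0%N = mu1 1%N + h *: muc 1%N - h *: dl_xi0 l (xi0 0%N) (xi1 0%N);
  EL_mu0_0 : mu0 0%N = dual (Dtau_inv L tau (h *: xi0 0%N)) (muc 1%N);
  EL_mu0_S : forall k, (k < N)%N ->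
    mu0 k.+1 = dual (Dtau_inv L tau (- (h *: xi0 k))) (muc k.+1);
  EL_D1 : forall k, (k < N)%N ->
    [/\ g k.+1 = (tau (h *: xi0 k) * g k)%g,
        'pinv_(fun=> 0) U tau (g k.+1 * (g k)^-1)%g = h *: xi0 k &
        xi0 k.+1 = xi0 k + h *: xi1 k];
  EL_D2 : forall k, (1 <= k < N)%N ->
    mu1 k.+1 = mu1 k - h *: dual (Dtau L tau (- (h *: xi0 k))) (mu0 k.+1)
               + h *: dl_xi0 l (xi0 k) (xi1 k);
  EL_D3 : forall k, (k < N)%N -> dl_xi1 l (xi0 k) (xi1 k) - mu1 k.+1 = 0;
  EL_D4 : forall k, (k < N)%N -> (forall i, (1 <= i <= p)%N -> k <> nd i) ->
    mu0 k.+1 = dual (Dtau_inv L tau (- (h *: xi0 k)))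
                 (dual (Dtau L tau (h *: xi0 k)) (mu0 k));
  (* The duals are written out as precompositions. *)
  EL_D5 : forall i k, (1 <= i < p)%N -> k = nd i -> forall eta : 'rV[R]_m,
    let eta' := Dtau L tau (h *: xi0 k) (Dtau_inv L tau (- (h *: xi0 k)) eta) in
    mu0 k.+1 eta = mu0 k eta' + node_force sigma (act (g k) Q0) (Qt i) eta';
  EL_D6 : forall eta : 'rV[R]_m,
    mu0 N eta + node_force sigma (act (g N) Q0) (Qt p) eta = 0;
  EL_D7 : mu1 N = 0 }.

End DiscreteEulerLagrange.

(* Main.v *)
(* Since [tau (- xi) = (tau xi)^-1], differentiating [tau y * tau (- y) = 1] at
   [xi] gives [Ad_(tau xi) o Dtau_xi = Dtau_(- xi)].  Hence (D4) and (D5) say that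
   [mu0 k.+1 o Ad_(tau (h xi0 k))] equals [mu0 k], up to a multiple of
   [J^Q (d_1 d)] at a node.  The latter vanishes on the isotropy algebra of
   [g k Q0], which [Ad_(tau (h xi0 k))] maps into that of [g k.+1 Q0], so the claim
   propagates backwards from (D6).

   The invariance of isotropy algebras rests on
   [exp (Ad_a xi) = a * exp xi * a^-1].  As [lie_exp] chooses a one-parameter
   subgroup, or returns [1] if there is none, this needs the uniqueness of
   one-parameter subgroups and the smoothness of their conjugates, but not their
   existence. *)
Require Import Defs.
From HB Require Import structures.
From mathcomp Require Import all_boot all_order all_algebra.
From mathcomp Require Import all_classical all_reals all_analysis.
Set Implicit Arguments.
Unset Strict Implicit.
Unset Printing Implicit Defensive.
Import Order.TTheory GRing.Theory Num.Theory numFieldNormedType.Exports.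
Local Open Scope classical_set_scope.
Local Open Scope ring_scope.

(** * Calculus of [C^k] maps between normed spaces *)

Section Calculus.
Context {R : realType}.
Implicit Types V W : normedModType R.

(** The remainder in the expansion of [f] is only tested near [0], so the expansion holds for [g] as
    well. The conjunction is what both [diff_unique] and [diff_locallyP] ask for. *)
Lemma near_eq_diff_locally V W (f g : V -> W) (x : V) :
  (\near x, f x = g x) -> differentiable f x ->
  continuous ('d f x) /\ g \o shift x = cst (g x) + 'd f x +o_ 0 id.
Proof.
move=> fg df; split; first exact: diff_continuous.
apply/eqaddoP => e e0.
have /eqaddoP/(_ e e0) := diff_locally df.
have : \forall y \near 0, f (y + x) = g (y + x).
  by move: fg; rewrite (near_shift 0) subr0.
have fgx := nbhs_singleton fg.
by apply: filterS2 => y /=; rewrite !fctE /= fgx => ->.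
Qed.

Lemma near_eq_diff V W (f g : V -> W) (x : V) :
  (\near x, f x = g x) -> differentiable f x -> 'd g x = 'd f x :> (V -> W).
Proof.
by move=> fg df; have [? ?] := near_eq_diff_locally fg df; exact: diff_unique.
Qed.

Lemma near_eq_differentiable V W (f g : V -> W) (x : V) :
  (\near x, f x = g x) -> differentiable f x -> differentiable g x.
Proof.
move=> fg df; apply/diff_locallyP; rewrite (near_eq_diff fg df).
exact: near_eq_diff_locally.
Qed.

Lemma near_eq_Ck_on k V W (U : set V) (f g : V -> W) :
  (forall x, U x -> \near x, f x = g x) -> Ck_on k U f -> Ck_on k U g.
Proof.
elim: k f g => [|k IH] f g fg /=.
  move=> cf x Ux; have fgx := fg x Ux.
  rewrite /prop_for /continuous_at -(nbhs_singleton fgx).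
  apply: cvg_trans (cf x Ux); apply: near_eq_cvg.
  by apply: filterS fgx => y ->.
case=> df Df; split=> [x Ux|v].
  exact: near_eq_differentiable (fg x Ux) (df x Ux).

(* [near_join] turns equality near [x] into equality near each point near [x], so the derivatives
   also agree near [x]. *)
by apply: IH (Df v) => x /fg /near_join; apply: filterS => y; exact: near_eq_derive.
Qed.

Lemma eq_Ck_on k V W (U : set V) (f g : V -> W) : open U ->
  (forall x, U x -> f x = g x) -> Ck_on k U f -> Ck_on k U g.
Proof.
move=> oU fg; apply: near_eq_Ck_on => x Ux.
by apply: filterS (open_nbhs_nbhs (conj oU Ux)) => y; exact: fg.
Qed.

Lemma sub_Ck_on k V W (U U' : set V) (f : V -> W) :
  U' `<=` U -> Ck_on k U f -> Ck_on k U' f.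
Proof.
move=> sU; elim: k f => [|k IH] f /= Cf; first by move=> x /sU; exact: Cf.
by case: Cf => df Df; split=> [x /sU|v]; [exact: df|exact: IH].
Qed.

(** [Ck_on] tests a total function and its total directional derivatives point by point, so no
    gluing is involved. *)
Lemma local_Ck_on k V W (U : set V) (f : V -> W) :
  (forall x, U x -> exists2 U', U' x & Ck_on k U' f) -> Ck_on k U f.
Proof.
elim: k f => [|k IH] f /= Cf.
  by move=> x /Cf [U' U'x]; exact.
split=> [x /Cf [U' U'x [df _]]|v]; first exact: df.
by apply: IH => x /Cf [U' U'x [_ Df]]; exists U'.
Qed.

Lemma Ck_onW k V W (U : set V) (f : V -> W) : Ck_on k.+1 U f -> Ck_on k U f.
Proof.
elim: k f => [|k IH] f [df Df].
  by move=> x /df; exact: differentiable_continuous.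
by split=> // v; exact: IH.
Qed.

Lemma Ck_onD k V W (U : set V) (f g : V -> W) : open U ->
  Ck_on k U f -> Ck_on k U g -> Ck_on k U (fun x => f x + g x).
Proof.
move=> oU; elim: k f g => [|k IH] f g.
  by move=> cf cg x Ux; apply: cvgD; [exact: cf|exact: cg].
case=> df Df [dg Dg]; split=> [x Ux|v].
  by apply: differentiableD; [exact: df|exact: dg].
apply: eq_Ck_on (IH _ _ (Df v) (Dg v)) => // x Ux.
by rewrite -deriveD//; apply: diff_derivable; [exact: df|exact: dg].
Qed.

Lemma Ck_on_sum k V W (U : set V) n (f : 'I_n -> V -> W) : open U ->
  (forall i, Ck_on k U (f i)) -> Ck_on k U (fun x => \sum_(i < n) f i x).
Proof.
move=> oU Cf; elim: n f Cf => [|n IH] f Cf.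
  under eq_fun do rewrite big_ord0.
  elim: k {Cf} => [|k IHk] /=; first by move=> x _; exact: cvg_cst.
  split=> [x _|v]; first exact: differentiable_cst.
  by apply: eq_Ck_on IHk => // x _; rewrite derive_cst.
under eq_fun do rewrite big_ord_recr /=.
by apply: Ck_onD => //; exact: IH.
Qed.

Lemma Ck_onM k V (U : set V) (f g : V -> R^o) : open U ->
  Ck_on k U f -> Ck_on k U g -> Ck_on k U (fun x => f x * g x : R^o).
Proof.
move=> oU; elim: k f g => [|k IH] f g.
  by move=> cf cg x Ux; apply: cvgM; [exact: cf|exact: cg].
move=> Cf Cg; have [df Df] := Cf; have [dg Dg] := Cg; split=> [x Ux|v].
  by apply: differentiableM; [exact: df|exact: dg].
(* In the Leibniz rule the derivatives are of class [C^k], and [Ck_onW] lowers the undifferentiated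
   factors to that class. *)
have := Ck_onD oU (IH _ _ (Ck_onW Cf) (Dg v)) (IH _ _ (Ck_onW Cg) (Df v)).
apply: eq_Ck_on => // x Ux.
by rewrite [RHS]deriveM//; apply: diff_derivable; [exact: df|exact: dg].
Qed.

(** A continuous linear map commutes with directional derivatives, so the induction stays among maps
    [l \o _]. *)
Lemma Ck_on_linear k V W W' (U : set V) (l : {linear W -> W'}) (f : V -> W) :
  open U -> continuous l -> Ck_on k U f -> Ck_on k U (l \o f).
Proof.
move=> oU cl; elim: k f => [|k IH] f.
  by move=> cf x Ux; apply: continuous_comp; [exact: cf|exact: cl].
have dl y : differentiable l y by exact: linear_differentiable.
case=> df Df; split=> [x /df ?|v]; first exact: differentiable_comp.
apply: eq_Ck_on (IH _ (Df v)) => // x /df dfx.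
rewrite (deriveE v (differentiable_comp dfx (dl (f x)))) diff_comp //=.
by rewrite -(deriveE v dfx) (diff_lin _ cl).
Qed.

Lemma Ck_on_coord k V (U : set V) m n (f : V -> 'M[R]_(m, n)) i j : open U ->
  Ck_on k U f -> Ck_on k U (fun x => f x i j : R^o).
Proof.
move=> oU.
have @l : {linear 'M[R]_(m, n) -> R^o}.
  by exists (fun N : 'M[R]_(_, _) => N i j); do 2![eexists]; do ?[constructor];
     rewrite ?mxE// => ? *; rewrite ?mxE//; move=> ?; rewrite !mxE.
by apply: (@Ck_on_linear k _ _ _ U l) => //; exact: coord_continuous.
Qed.

Lemma Ck_on_row k V (U : set V) n (f : V -> 'rV[R]_n) : open U ->
  (forall j, Ck_on k U (fun x => f x 0 j : R^o)) -> Ck_on k U f.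
Proof.
move=> oU Cf.
apply: (@eq_Ck_on _ _ _ _ (fun x => \sum_(j < n) f x 0 j *: delta_mx 0 j)) => //.
  by move=> x _; rewrite -row_sum_delta.
apply: Ck_on_sum => // j.
have lin_scal : linear (fun a : R^o => a *: (delta_mx 0 j : 'rV[R]_n)).
  by move=> a b c; rewrite scalerDl scalerA.
pose l : {linear R^o -> 'rV[R]_n} :=
  HB.pack (fun a : R^o => a *: (delta_mx 0 j : 'rV[R]_n))
    (GRing.isLinear.Build _ _ _ _ _ lin_scal).
by apply: (@Ck_on_linear k _ _ _ U l) (Cf j) => //; exact: scalel_continuous.
Qed.

(** The chain rule in coordinates: for scalar [g] the derivative is a sum of products, to which
    [Ck_on_sum] and [Ck_onM] apply. *)
Lemma derive_comp_row V W m (f : V -> 'rV[R]_m) (g : 'rV[R]_m -> W) x v :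
  differentiable f x -> differentiable g (f x) ->
  'D_v (g \o f) x = \sum_(i < m) 'D_v f x 0 i *: 'D_(delta_mx 0 i) g (f x).
Proof.
move=> df dg; rewrite deriveE; last exact: differentiable_comp.
rewrite diff_comp//= -(deriveE _ df) {1}['D_v f x]row_sum_delta linear_sum.
by apply: eq_bigr => i _; rewrite linearZ (deriveE _ dg).
Qed.

Lemma Ck_on_comp_scalar k V m (U : set V) (U' : set 'rV[R]_m)
    (f : V -> 'rV[R]_m) (g : 'rV[R]_m -> R^o) :
  open U -> (forall x, U x -> U' (f x)) ->
  Ck_on k U f -> Ck_on k U' g -> Ck_on k U (g \o f).
Proof.
move=> oU fU; elim: k g => [|k IH] g Cf Cg.
  by move=> x Ux; apply: continuous_comp; [exact: Cf|exact/Cg/fU].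
have [df Df] := Cf; have [dg Dg] := Cg.
split=> [x Ux|v].
  by apply: differentiable_comp; [exact: df|exact/dg/fU].
apply: (@eq_Ck_on _ _ _ _ (fun x => \sum_(i < m)
    ('D_v f x 0 i * ('D_(delta_mx 0 i) g \o f) x : R^o))) => //.
  by move=> x Ux; rewrite derive_comp_row//; [exact: df|exact/dg/fU].
apply: Ck_on_sum => // i; apply: Ck_onM => //; first exact: (Ck_on_coord 0 i oU (Df v)).
exact: IH (Ck_onW Cf) (Dg _).
Qed.

Lemma Ck_on_comp k V m n (U : set V) (U' : set 'rV[R]_m)
    (f : V -> 'rV[R]_m) (g : 'rV[R]_m -> 'rV[R]_n) :
  open U -> open U' -> (forall x, U x -> U' (f x)) ->
  Ck_on k U f -> Ck_on k U' g -> Ck_on k U (g \o f).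
Proof.
move=> oU oU' fU Cf Cg; apply: Ck_on_row => // j.
exact: (Ck_on_comp_scalar oU fU Cf (Ck_on_coord 0 j oU' Cg)).
Qed.

(** Meant for the inclusion of a factor into a product, whose target is not a row space as
    [Ck_on_comp] requires. Differentiating along [v] gives a derivative of [g] in the constant
    direction [l v], after the same affine map. *)
Lemma Ck_on_comp_affine k V V' W (U : set V) (U' : set V') (l : {linear V -> V'})
    (a : V') (g : V' -> W) :
  continuous l -> (forall x, U x -> U' (a + l x)) ->
  Ck_on k U' g -> Ck_on k U (fun x => g (a + l x)).
Proof.
move=> cl lU; elim: k g => [|k IH] g Cg.
  move=> x Ux; apply: (@continuous_comp _ _ _ (fun x => a + l x) g).
    by apply: cvgD; [exact: cvg_cst|exact: cl].
  exact/Cg/lU.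
have [dg Dg] := Cg; split=> [x Ux|v].
  apply: (@differentiable_comp _ _ _ _ (fun x => a + l x) g); last exact/dg/lU.
  apply: differentiableD; first exact: differentiable_cst.
  exact: linear_differentiable.
(* The difference quotients coincide as functions, so the derivatives agree at every point, whether
   or not [g] is differentiable there. *)
suff -> : (fun x => 'D_v (fun x => g (a + l x)) x) =
          (fun x => 'D_(l v) g (a + l x)) by exact: (IH _ (Dg (l v))).
apply/funext => x; rewrite /derive.
suff -> : (fun h => h^-1 *: (((fun x => g (a + l x)) \o shift x) (h *: v) -
  g (a + l x))) = (fun h => h^-1 *: ((g \o shift (a + l x)) (h *: l v) -
  g (a + l x))) by [].
by apply/funext => h /=; rewrite (linearD l) (linearZ_LR l) addrCA.
Qed.

End Calculus.

(** * Differentiability and tangent maps in charts *)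

Lemma open_setX (S T : topologicalType) (A : set S) (B : set T) :
  open A -> open B -> open (A `*` B).
Proof.
move=> oA oB; rewrite openE => -[x y] [/= Ax By].
by exists (A, B) => //; split; exact: open_nbhs_nbhs.
Qed.

Section TangentMaps.
Context {R : realType}.
Implicit Types (M N P : topologicalType) (E : normedModType R).

(** Continuity of [F] keeps nearby values in the domain of [c']. Differentiability of the
    representative does not ensure this, as [c'] is a total function with arbitrary values outside
    its domain. *)
Definition mdiff M N E E' (c : chart M E) (c' : chart N E') (F : M -> N) (p : M) :=
  [/\ chart_dom c p, chart_dom c' (F p), {for p, continuous F} &
      differentiable (c' \o F \o chart_inv c) (c p)].

Lemma id_chartP E : is_chart (id_chart E).
Proof.
split => //=; first exact: openT.
- by rewrite image_id; exact: openT.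
- by move=> x _; exact: cvg_id.
- by move=> x _; exact: cvg_id.
Qed.

Lemma cvg_chart_inv M E (c : chart M E) p : is_chart c -> chart_dom c p ->
  chart_inv c y @[y --> c p] --> p.
Proof.
by move=> cP cp; rewrite -[X in _ --> X](chartK cP cp); exact: (chart_inv_cont cP).
Qed.

Lemma near_chartK M E (c : chart M E) p : is_chart c -> chart_dom c p ->
  \forall y \near c p, c (chart_inv c y) = y.
Proof.
move=> cP cp.
have := open_nbhs_nbhs (conj (chart_open_im cP) (ex_intro2 _ _ p cp erefl)).
by apply: filterS => _ [x cx <-]; rewrite (chartK cP).
Qed.

(** Inside the open image of the chart, this set is the preimage of [O] under [chart_inv c], which
    is continuous there. *)
Lemma open_chart_image M E (c : chart M E) (O : set M) : is_chart c ->
  (forall x, chart_dom c x -> O x -> nbhs x O) -> open (c @` (chart_dom c `&` O)).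
Proof.
move=> cP Onbhs; rewrite openE => _ [x [cx Ox] <-]; rewrite /interior.
have cO := cvg_chart_inv cP cx (Onbhs x cx Ox).
have := open_nbhs_nbhs (conj (chart_open_im cP) (ex_intro2 _ _ x cx erefl)).
move=> cc; apply: filterS2 cc cO => _ [y cy <-]; rewrite /= (chartK cP) // => Oy.
by exists y.
Qed.

Lemma prod_chartP M N E E' (c : chart M E) (c' : chart N E') :
  is_chart c -> is_chart c' -> is_chart (prod_chart c c').
Proof.
move=> cP c'P.
have imE : prod_chart c c' @` chart_dom (prod_chart c c') =
    (c @` chart_dom c) `*` (c' @` chart_dom c').
  apply/seteqP; split=> [_ [x [cx c'x] <-]|[v w] [/= [x cx <-] [y c'y <-]]].
    by split; [exists x.1|exists x.2].
  by exists (x, y).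
split=> /=.
- exact: open_setX (chart_open_dom cP) (chart_open_dom c'P).
- by rewrite imE; exact: open_setX (chart_open_im cP) (chart_open_im c'P).
- by move=> [x y] [/= cx c'y]; rewrite (chartK cP) // (chartK c'P).
- move=> x [cx c'x]; apply: cvg_pair.
    by apply: (@continuous_comp _ _ _ fst c); [exact: cvg_fst|exact: (chart_cont cP)].
  by apply: (@continuous_comp _ _ _ snd c'); [exact: cvg_snd|exact: (chart_cont c'P)].
- move=> x [cx c'x]; apply: cvg_pair.
    apply: (@continuous_comp _ _ _ fst (chart_inv c)); first exact: cvg_fst.
    exact: (chart_inv_cont cP).
  apply: (@continuous_comp _ _ _ snd (chart_inv c')); first exact: cvg_snd.
  exact: (chart_inv_cont c'P).
Qed.

Lemma mdiff_mfd_map r M N E E' (A : set (chart M E)) (B : set (chart N E'))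
    D F c c' p :
  mfd_map r A B D F -> A c -> B c' -> D p -> chart_dom c p -> chart_dom c' (F p) ->
  mdiff c c' F p.
Proof.
case=> cF sF Ac Bc' Dp cp c'p; split=> //; first exact: cF.
have /(_ 1%N) [+ _] : smooth_on (c @` (chart_dom c `&` D `&` F @^-1` chart_dom c'))
    (c' \o F \o chart_inv c).
  by case: r sF => sF; [exact: sF|exact: (sF _ _ Ac Bc').1].
by apply; exists p.
Qed.

(** Composing with the identity read in two charts transfers [mdiff] from one chart to another. *)
Lemma mdiff_transition r M E (A : set (chart M E)) c c' p :
  is_atlas r A -> A c -> A c' -> chart_dom c p -> chart_dom c' p ->
  mdiff c c' id p.
Proof.
move=> aA Ac Ac' cp c'p; split=> //.
have /(_ 1%N) [+ _] : smooth_on (c @` (chart_dom c `&` chart_dom c'))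
    (c' \o chart_inv c).
  by case: r aA => aA; [|apply: proj1]; apply: (atlas_transition aA).
by apply; exists p.
Qed.

Section Composition.
Context {M N P : topologicalType} {E E' E'' : normedModType R}.
Variables (c : chart M E) (c' : chart N E') (c'' : chart P E'').
Variables (F : M -> N) (F' : N -> P) (p : M).
Hypotheses (cP : is_chart c) (c'P : is_chart c').
Hypotheses (dF : mdiff c c' F p) (dF' : mdiff c' c'' F' (F p)).

(** Inserting [chart_inv c' \o c'] is harmless while [F] takes values in the domain of [c'], which
    its continuity guarantees near [p]. *)
Let comp_germ : \forall y \near c p,
  ((c'' \o F' \o chart_inv c') \o (c' \o F \o chart_inv c)) y =
  (c'' \o (F' \o F) \o chart_inv c) y.
Proof.
case: dF => cp c'p cF _.
have := open_nbhs_nbhs (conj (chart_open_dom c'P) c'p).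
move=> /cF /(cvg_chart_inv cP cp); rewrite /nbhs /=.
by apply: filterS => y c'y /=; rewrite (chartK c'P).
Qed.

Let dF1 : differentiable (c' \o F \o chart_inv c) (c p).
Proof. by case: dF. Qed.

Let dF2 : differentiable (c'' \o F' \o chart_inv c') ((c' \o F \o chart_inv c) (c p)).
Proof. by rewrite /= (chartK cP) //; [case: dF'|case: dF]. Qed.

Lemma mdiff_comp : mdiff c c'' (F' \o F) p.
Proof.
case: dF dF' => cp c'p cF dF3 [_ c''p cF' dF4]; split=> //.
  exact: continuous_comp.
by apply: near_eq_differentiable comp_germ _; exact: differentiable_comp.
Qed.

Lemma tangent_map_comp :
  tangent_map c c'' (F' \o F) p =
  tangent_map c' c'' F' (F p) \o tangent_map c c' F p :> (E -> E'').
Proof.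
rewrite /tangent_map (near_eq_diff comp_germ (differentiable_comp dF1 dF2)).
by rewrite (diff_comp dF1 dF2) /= (chartK cP) //; case: dF.
Qed.

End Composition.

Section Pair.
Context {M N P : topologicalType} {E E' E'' : normedModType R}.
Variables (c : chart M E) (c' : chart N E') (c'' : chart P E'').
Variables (F : M -> N) (F' : M -> P) (p : M).
Hypotheses (dF : mdiff c c' F p) (dF' : mdiff c c'' F' p).

Lemma mdiff_pair : mdiff c (prod_chart c' c'') (fun x => (F x, F' x)) p.
Proof.
case: dF dF' => cp c'p cF dF3 [_ c''p cF' dF4]; split=> //.
  exact: cvg_pair.
exact: (differentiable_pair dF3 dF4).
Qed.

Lemma tangent_map_pair v :
  tangent_map c (prod_chart c' c'') (fun x => (F x, F' x)) p v =
  (tangent_map c c' F p v, tangent_map c c'' F' p v).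
Proof.
case: dF dF' => cp c'p cF dF3 [_ c''p cF' dF4].
by rewrite {1}/tangent_map [LHS](congr1 (@^~ v) (diff_pair dF3 dF4)).
Qed.

End Pair.

Lemma mdiff_cst M N E E' (c : chart M E) (c' : chart N E') p q :
  chart_dom c p -> chart_dom c' q -> mdiff c c' (fun=> q) p.
Proof.
by move=> cp c'q; split => //; [exact: cvg_cst|exact: differentiable_cst].
Qed.

Lemma tangent_map_cst M N E E' (c : chart M E) (c' : chart N E') p q v :
  tangent_map c c' (fun=> q) p v = 0.
Proof. exact: (congr1 (@^~ v) (diff_cst (c' q) (c p))). Qed.

Lemma mdiff_id M E (c : chart M E) p :
  is_chart c -> chart_dom c p -> mdiff c c id p.
Proof.
move=> cP cp; split => //.
apply: (@near_eq_differentiable _ _ _ id); last exact: ex_diff.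
by apply: filterS (near_chartK cP cp) => y /= ->.
Qed.

Lemma tangent_map_id M E (c : chart M E) p v :
  is_chart c -> chart_dom c p -> tangent_map c c id p v = v.
Proof.
move=> cP cp; rewrite /tangent_map (@near_eq_diff _ _ _ id).
- by rewrite diff_val.
- by apply: filterS (near_chartK cP cp) => y /= ->.
- exact: ex_diff.
Qed.

Lemma mdiff_opp E (x : E) : mdiff (id_chart E) (id_chart E) -%R x.
Proof. by split=> //; exact: opp_continuous. Qed.

Lemma tangent_map_opp E (x v : E) :
  tangent_map (id_chart E) (id_chart E) -%R x v = - v.
Proof.
have did : differentiable (id : E -> E) x by exact: ex_diff.
by rewrite [LHS](congr1 (@^~ v) (diffN did)) /= diff_val.
Qed.

(** The claim is local: around each [p], the composite is read through a chart [c'] at [F p], and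
    [Ck_on_comp] applies to the two representatives. *)
Lemma mfd_map_comp M N P E n n' (A : set (chart M E))
    (B : set (chart N 'rV[R]_n)) (C : set (chart P 'rV[R]_n')) F F' :
  (forall c, A c -> is_chart c) -> is_atlas Smooth B ->
  (forall c, C c -> is_chart c) ->
  mfd_map Smooth A B setT F -> mfd_map Smooth B C setT F' ->
  mfd_map Smooth A C setT (F' \o F).
Proof.
move=> AP BP CP [cF sF] [cF' sF']; split=> [x _|c c'' Ac Cc'' k].
  by apply: continuous_comp; [exact: cF|exact: cF'].
have cP := AP c Ac; have c''P := CP c'' Cc''.
apply: local_Ck_on => _ [p [[cp _] c''p] <-].
have [c' Bc' c'p] := atlas_cover BP (F p).
have c'P := atlas_chart BP Bc'.
have nbF' x : chart_dom c'' (F' x) -> nbhs x (F' @^-1` chart_dom c'').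
  by move=> c''x; exact: cF' (open_nbhs_nbhs (conj (chart_open_dom c''P) c''x)).
(* [O] consists of the intermediate points at which [c'] is valid and whose image under [F'] lies in
   the domain of [c'']. *)
pose O := chart_dom c' `&` F' @^-1` chart_dom c''.
have nbO x : O x -> nbhs x O.
  move=> [c'x c''x]; apply: filterI; last exact: nbF'.
  exact: open_nbhs_nbhs (conj (chart_open_dom c'P) c'x).
exists (c @` (chart_dom c `&` F @^-1` O)); first by exists p.
have oW : open (c @` (chart_dom c `&` F @^-1` O)).
  by apply: open_chart_image => // x _ /nbO; exact: cF.
apply: (@eq_Ck_on _ _ _ _ _
    ((c'' \o F' \o chart_inv c') \o (c' \o F \o chart_inv c))) => //.
  by move=> _ [x [cx [c'x c''x]] <-] /=; rewrite (chartK cP) // (chartK c'P).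
apply: (@Ck_on_comp _ _ _ _ _ _
    (c' @` (chart_dom c' `&` setT `&` F' @^-1` chart_dom c''))); [exact: oW| | | |].
- by rewrite -setIA setTI; apply: open_chart_image => // x _; exact: nbF'.
- move=> _ [x [cx [c'x c''x]] <-] /=; exists (F x) => //.
  by rewrite (chartK cP).
- apply: sub_Ck_on (sF _ _ Ac Bc' k) => _ [x [cx [c'x c''x]] <-].
  by exists x.
- exact: sF'.
Qed.

End TangentMaps.

(** The mean value theorem is a scalar statement, so it is applied to each coordinate. *)
Lemma constant_of_diff0 (R : realType) n (f : R^o -> 'rV[R]_n) (b : R) :
  0 <= b ->
  (forall t, 0 <= t <= b -> differentiable f t /\ 'd f t 1 = 0) -> f b = f 0.
Proof.
move=> b0 f'0; apply/rowP => j.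
have fj t : 0 <= t <= b -> is_derive (t : R^o) 1 (fun t => f t 0 j : R) 0.
  move=> /f'0 [dft dft0].
  have dert : derivable f t 1 by exact: diff_derivable.
  apply: DeriveDef; first by have /derivable_mxP := dert; exact.
  have := congr1 (fun v : 'rV[R]_n => v 0 j) (derive_mx dert).
  by rewrite mxE (deriveE _ dft) dft0 mxE => <-.
have [||t _ /eqP] := @MVT_segment R (fun t => f t 0 j) (fun=> 0) 0 b b0.
- by move=> t; rewrite in_itv /= => /andP[/ltW ? /ltW ?]; apply: fj; apply/andP.
- apply: derivable_within_continuous => t; rewrite in_itv /= => /fj [].
  by [].
- by rewrite mul0r subr_eq0 => /eqP.
Qed.

(** * Differentiating products in a Lie group, and the adjoint representation *)

Section LieGroup.
Context {R : realType} {m : nat} {G : topGroupType} (L : lie_group (R := R) m G).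
Implicit Types (a b : G) (xi eta v : 'rV[R]_m).

Let c1 : chart G 'rV[R]_m := chart_at L 1%g.

Let LA : is_atlas Smooth (atlas L) := atlasP L.

Let c1A : atlas L c1. Proof. exact: chart_at_atlas. Qed.

Let c1_1 : chart_dom c1 1%g. Proof. exact: mem_chart_at. Qed.

Let LP c : atlas L c -> is_chart c. Proof. exact: (atlas_chart LA). Qed.

Let c1P : is_chart c1. Proof. exact: LP. Qed.

Lemma mdiff_mul2 c c' c'' a b : atlas L c -> atlas L c' -> atlas L c'' ->
  chart_dom c a -> chart_dom c' b -> chart_dom c'' (a * b)%g ->
  mdiff (prod_chart c c') c'' (fun p : G * G => (p.1 * p.2)%g) (a, b).
Proof.
move=> Ac Ac' Ac'' ca c'b c''ab.
have [_ mulS _] := lie_group_atlas L.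
apply: (mdiff_mfd_map mulS) => //.
by exists c => //; exists c'.
Qed.

Section Product.
Context {M : topologicalType} {E : normedModType R}.
Variables (c : chart M E) (p : M) (F F' : M -> G).
Hypothesis cP : is_chart c.

Lemma mdiff_mul c' c'' d : atlas L c' -> atlas L c'' -> atlas L d ->
  mdiff c c' F p -> mdiff c c'' F' p -> chart_dom d (F p * F' p)%g ->
  mdiff c d (fun x => F x * F' x)%g p.
Proof.
move=> Ac' Ac'' Ad dF dF' dFF'.
have dm : mdiff (prod_chart c' c'') d (fun p : G * G => (p.1 * p.2)%g) (F p, F' p).
  by apply: mdiff_mul2 => //; [case: dF|case: dF'].
exact: (mdiff_comp cP (prod_chartP (LP Ac') (LP Ac'')) (mdiff_pair dF dF') dm).
Qed.

End Product.

(** By linearity it suffices to treat [(v, 0)] and [(0, w)]. They are tangent to [x |-> (x, 1)] and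
    [x |-> (1, x)], along which multiplication is the identity. *)
Lemma tangent_map_mul2 v w :
  tangent_map (prod_chart c1 c1) c1 (fun p : G * G => (p.1 * p.2)%g) (1%g, 1%g)
    (v, w) = v + w.
Proof.
have dm : mdiff (prod_chart c1 c1) c1 (fun p : G * G => (p.1 * p.2)%g) (1%g, 1%g).
  by apply: mdiff_mul2 => //; rewrite mulg1.
have pP := prod_chartP c1P c1P.
have did := mdiff_id c1P c1_1.
have dcst := mdiff_cst c1_1 c1_1.
have Tl : tangent_map (prod_chart c1 c1) c1 (fun p : G * G => (p.1 * p.2)%g)
    (1%g, 1%g) (v, 0) = v.
  have := tangent_map_comp c1P pP (mdiff_pair did dcst) dm.
  move=> /(congr1 (@^~ v)) /=; rewrite (tangent_map_pair did dcst).
  rewrite (tangent_map_id _ c1P c1_1) tangent_map_cst => <-.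
  rewrite (_ : _ \o _ = id) ?(tangent_map_id _ c1P c1_1) //.
  by apply/funext => x /=; rewrite mulg1.
have Tr : tangent_map (prod_chart c1 c1) c1 (fun p : G * G => (p.1 * p.2)%g)
    (1%g, 1%g) (0, w) = w.
  have := tangent_map_comp c1P pP (mdiff_pair dcst did) dm.
  move=> /(congr1 (@^~ w)) /=; rewrite (tangent_map_pair dcst did).
  rewrite (tangent_map_id _ c1P c1_1) tangent_map_cst => <-.
  rewrite (_ : _ \o _ = id) ?(tangent_map_id _ c1P c1_1) //.
  by apply/funext => x /=; rewrite mul1g.
rewrite (_ : (v, w) = (v, 0) + (0, w)); last by congr pair; rewrite ?addr0 ?add0r.
by rewrite -[X in _ = X + _]Tl -[X in _ = _ + X]Tr; exact: linearD.
Qed.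

Lemma tangent_map_mul (M : topologicalType) (E : normedModType R)
    (c : chart M E) (p : M) (F F' : M -> G) (v : E) :
  is_chart c -> mdiff c c1 F p -> mdiff c c1 F' p -> F p = 1%g -> F' p = 1%g ->
  tangent_map c c1 (fun x => F x * F' x)%g p v =
  tangent_map c c1 F p v + tangent_map c c1 F' p v.
Proof.
move=> cP dF dF' F1 F'1.
have dm : mdiff (prod_chart c1 c1) c1 (fun p : G * G => (p.1 * p.2)%g) (F p, F' p).
  by apply: mdiff_mul2; rewrite ?F1 ?F'1 ?mulg1.
have := tangent_map_comp cP (prod_chartP c1P c1P) (mdiff_pair dF dF') dm.
move=> /(congr1 (@^~ v)) /=; rewrite (tangent_map_pair dF dF').
by rewrite F1 F'1 tangent_map_mul2.
Qed.

(** This form covers left translations, conjugations, and the two-sided translations in the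
    uniqueness argument for one-parameter subgroups. *)
Lemma mdiff_lrmul c c' a b p : atlas L c -> atlas L c' -> chart_dom c p ->
  chart_dom c' (a * p * b)%g -> mdiff c c' (fun x => a * x * b)%g p.
Proof.
move=> Ac Ac' cp c'p; have cP := LP Ac.
have cst q : mdiff c (chart_at L q) (fun=> q) p.
  by apply: mdiff_cst => //; exact: mem_chart_at.
apply: (mdiff_mul cP (c' := chart_at L (a * p)%g) (c'' := chart_at L b)) => //;
  try exact: chart_at_atlas.
apply: (mdiff_mul cP (c' := chart_at L a) (c'' := c)) => //;
  try exact: chart_at_atlas.
- exact: mdiff_id.
- exact: mem_chart_at.
Qed.

Definition Ad a v := tangent_map c1 c1 (fun x => a * x * a^-1)%g 1%g v.

Let mdiff_conj a : mdiff c1 c1 (fun x => a * x * a^-1)%g 1%g.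
Proof. by apply: mdiff_lrmul => //; rewrite mulg1 mulgV. Qed.

(** Conjugation by [a * b] is a composite of two conjugations, and the inner one fixes [1], so the
    chain rule only involves tangent maps at [1]. *)
Lemma AdM a b v : Ad (a * b)%g v = Ad a (Ad b v).
Proof.
have d2 : mdiff c1 c1 (fun x => a * x * a^-1)%g (b * 1 * b^-1)%g.
  by rewrite mulg1 mulgV.
have := tangent_map_comp c1P c1P (mdiff_conj b) d2.
move=> /(congr1 (@^~ v)) /=; rewrite mulg1 mulgV /Ad => <-.
rewrite (_ : (fun x => a * b * x / (a * b))%g =
  (fun x => a * x / a)%g \o (fun x => b * x / b)%g) //.
by apply/funext => x /=; rewrite invgM !mulgA.
Qed.

Lemma Ad1 v : Ad 1%g v = v.
Proof.
rewrite /Ad (_ : (fun x => _) = id) ?(tangent_map_id _ c1P c1_1) //.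
by apply/funext => x; rewrite invg1 mulg1 mul1g.
Qed.

Lemma AdK a : cancel (Ad a) (Ad a^-1%g).
Proof. by move=> v; rewrite -AdM mulVg Ad1. Qed.

Lemma AdZ a (t : R) v : Ad a (t *: v) = t *: Ad a v.
Proof. exact: linearZ. Qed.

End LieGroup.

(** * One-parameter subgroups and the exponential *)

Lemma continuous_pair0l (R : realType) (V W : normedModType R) :
  continuous (fun y : V => (0 : W, y)).
Proof.
move=> y; exact: (@cvg_pair _ _ _ (nbhs y) (nbhs (0 : W)) (nbhs y) _ _ _
  (fun=> 0) id (cvg_cst _) cvg_id).
Qed.

Lemma continuous_pair0r (R : realType) (V W : normedModType R) :
  continuous (fun y : V => (y, 0 : W)).
Proof.
move=> y; exact: (@cvg_pair _ _ _ (nbhs y) (nbhs y) (nbhs (0 : W)) _ _ _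
  id (fun=> 0) cvg_id (cvg_cst _)).
Qed.

Section OneParameter.
Context {R : realType} {m : nat} {G : topGroupType} (L : lie_group (R := R) m G).
Implicit Types (a b : G) (xi eta v : 'rV[R]_m).

Let c1 : chart G 'rV[R]_m := chart_at L 1%g.

Let LA : is_atlas Smooth (atlas L) := atlasP L.

Let c1A : atlas L c1. Proof. exact: chart_at_atlas. Qed.

Let c1_1 : chart_dom c1 1%g. Proof. exact: mem_chart_at. Qed.

Let LP c : atlas L c -> is_chart c. Proof. exact: (atlas_chart LA). Qed.

Let c1P : is_chart c1. Proof. exact: LP. Qed.

Let continuous_mul (T : topologicalType) (F F' : T -> G) x :
  {for x, continuous F} -> {for x, continuous F'} ->
  {for x, continuous (fun y => F y * F' y)%g}.
Proof.
have [_ [cmul _] _] := lie_group_atlas L => cF cF'.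
apply: (@continuous_comp _ _ _ (fun y => (F y, F' y)) (fun p => p.1 * p.2)%g).
  exact: cvg_pair.
exact: cmul.
Qed.

Let continuous_lrmul a b : continuous (fun x : G => a * x * b)%g.
Proof.
move=> x; apply: (continuous_mul (F := fun y => a * y)%g); last exact: cvg_cst.
by apply: (continuous_mul (F := fun=> a)); [exact: cvg_cst|exact: cvg_id].
Qed.

(** Left translation is multiplication restricted to the slice through [a]. In a product chart the
    slice is the affine inclusion [y |-> (c0 a, y)], so [Ck_on_comp_affine] applies. *)
Lemma smooth_lmul a : mfd_map Smooth (atlas L) (atlas L) setT (fun x => a * x)%g.
Proof.
split=> [x _|c c'' Ac Ac'' k].
  rewrite (_ : (fun x => _) = (fun x => a * x * 1)%g); first exact: continuous_lrmul.
  by apply/funext => y; rewrite mulg1.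
have [_ [_ smul] _] := lie_group_atlas L.
pose c0 := chart_at L a.
have c0A : atlas L c0 by exact: chart_at_atlas.
have c0a : chart_dom c0 a by exact: mem_chart_at.
have lin_l : linear (fun y : 'rV[R]_m => (0, y) : 'rV[R]_m * 'rV[R]_m).
  by move=> t u v; congr pair; rewrite /= scaler0 addr0.
pose l : {linear 'rV[R]_m -> ('rV[R]_m * 'rV[R]_m)%type} :=
  HB.pack (fun y : 'rV[R]_m => (0, y) : 'rV[R]_m * 'rV[R]_m)
    (GRing.isLinear.Build _ _ _ _ _ lin_l).
have cl : continuous l by exact: continuous_pair0l.
have := smul (prod_chart c0 c) c''.
have pA : prod_atlas (atlas L) (atlas L) (prod_chart c0 c) by exists c0 => //; exists c.
move=> /(_ pA Ac'' k).
move=> /(Ck_on_comp_affine (U := c @` (chart_dom c `&` setT `&`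
  (fun x => a * x)%g @^-1` chart_dom c'')) (a := (c0 a, 0)) cl).
rewrite (_ : (fun x => _) = c'' \o (fun x => a * x)%g \o chart_inv c); last first.
  apply/funext => y /=; rewrite addr0 add0r.
  by rewrite (chartK (LP c0A)).
apply=> _ [x [[cx _] c''x] <-]; exists (a, x) => //.
by congr pair; rewrite /= ?addr0 ?add0r.
Qed.

Lemma smooth_rmul a : mfd_map Smooth (atlas L) (atlas L) setT (fun x => x * a)%g.
Proof.
split=> [x _|c c'' Ac Ac'' k].
  rewrite (_ : (fun x => _) = (fun x => 1 * x * a)%g); first exact: continuous_lrmul.
  by apply/funext => y; rewrite mul1g.
have [_ [_ smul] _] := lie_group_atlas L.
pose c0 := chart_at L a.
have c0A : atlas L c0 by exact: chart_at_atlas.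
have c0a : chart_dom c0 a by exact: mem_chart_at.
have lin_l : linear (fun y : 'rV[R]_m => (y, 0) : 'rV[R]_m * 'rV[R]_m).
  by move=> t u v; congr pair; rewrite /= scaler0 addr0.
pose l : {linear 'rV[R]_m -> ('rV[R]_m * 'rV[R]_m)%type} :=
  HB.pack (fun y : 'rV[R]_m => (y, 0) : 'rV[R]_m * 'rV[R]_m)
    (GRing.isLinear.Build _ _ _ _ _ lin_l).
have cl : continuous l by exact: continuous_pair0r.
have := smul (prod_chart c c0) c''.
have pA : prod_atlas (atlas L) (atlas L) (prod_chart c c0) by exists c => //; exists c0.
move=> /(_ pA Ac'' k).
move=> /(Ck_on_comp_affine (U := c @` (chart_dom c `&` setT `&`
  (fun x => x * a)%g @^-1` chart_dom c'')) (a := (0, c0 a)) cl).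
rewrite (_ : (fun x => _) = c'' \o (fun x => x * a)%g \o chart_inv c); last first.
  apply/funext => y /=; rewrite addr0 add0r.
  by rewrite (chartK (LP c0A)).
apply=> _ [x [[cx _] c''x] <-]; exists (x, a) => //.
by congr pair; rewrite /= ?addr0 ?add0r.
Qed.

Let idP c : [set id_chart R^o] c -> is_chart c.
Proof. by move=> ->; exact: id_chartP. Qed.

Let idRP : is_chart (id_chart R^o) := @id_chartP R R^o.

Lemma one_parameter_mdiff xi (c : R^o -> G) : one_parameter_subgroup L xi c ->
  mdiff (id_chart R^o) c1 c 0 /\ tangent_map (id_chart R^o) c1 c 0 1 = xi.
Proof.
case=> cD smc cxi.
have c0 : c 0 = 1%g by apply: (mulgI (c 0)); rewrite -cD addr0 mulg1.
have dc : mdiff (id_chart R^o) c1 c 0.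
  by apply: (mdiff_mfd_map smc) => //; rewrite c0.
split=> //; rewrite -cxi deriveE //.
by case: dc.
Qed.

Lemma one_parameter0 xi (c : R^o -> G) : one_parameter_subgroup L xi c -> c 0 = 1%g.
Proof. by case=> cD _ _; apply: (mulgI (c 0)); rewrite -cD addr0 mulg1. Qed.

Lemma one_parameterMn xi (c : R^o -> G) (t : R) k :
  one_parameter_subgroup L xi c -> c (t *+ k) = (c t ^+ k)%g.
Proof.
move=> cP; elim: k => [|k IH]; first by rewrite mulr0n expg0 (one_parameter0 cP).
by case: cP => cD _ _; rewrite mulrS cD IH expgS.
Qed.

(** Smoothness follows by composing [c] with two translations; the chain rule at [c 0 = 1] gives the
    velocity. *)
Lemma one_parameter_conj a xi (c : R^o -> G) : one_parameter_subgroup L xi c ->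
  one_parameter_subgroup L (Ad L a xi) (fun t => a * c t * a^-1)%g.
Proof.
move=> cP; have [dc Tc] := one_parameter_mdiff cP; have c0 := one_parameter0 cP.
have da : mdiff c1 c1 (fun x => a * x * a^-1)%g (c 0).
  by apply: (mdiff_lrmul (L := L)); rewrite ?c0 ?mulg1 ?mulgV.
case: cP => cD smc _; split.
- by move=> s t; rewrite cD !mulgA mulgVK.
- apply: (mfd_map_comp (F := fun t => (a * c t)%g) (F' := fun x => (x * a^-1)%g)
    idP LA LP _ (smooth_rmul _)).
  exact: (mfd_map_comp idP LA LP smc (smooth_lmul a)).
- have [_ _ _ d] := mdiff_comp idRP c1P dc da.
  rewrite [LHS](deriveE (1 : R^o) d).
  have := congr1 (@^~ 1) (tangent_map_comp idRP c1P dc da).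
  by rewrite /= Tc c0.
Qed.

(* [e t = (c t)^-1 * c' t] has vanishing velocity near [0]: since
   [e (t + s) = (c t)^-1 * e s * c' t], it suffices to check this at [0].  Hence
   [c = c'] near [0], and [c 1 = c (1 / k) ^+ k]. *)
Lemma one_parameter_unique xi (c c' : R^o -> G) :
  one_parameter_subgroup L xi c -> one_parameter_subgroup L xi c' -> c 1 = c' 1.
Proof.
move=> cP c'P.
have [dc Tc] := one_parameter_mdiff cP; have [dc' Tc'] := one_parameter_mdiff c'P.
have c0 := one_parameter0 cP; have c'0 := one_parameter0 c'P.
have [[cD [cc _] _] [c'D [cc' _] _]] := (cP, c'P).
pose e (t : R^o) := (c (- t) * c' t)%g.
have eD (t s : R) : e (s - t) = (c t * e s * c' (- t))%g.
  by rewrite /e c'D opprB cD !mulgA.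
have e0 : e 0 = 1%g by rewrite /e oppr0 c0 c'0 mulg1.
have dopp : mdiff (id_chart R^o) (id_chart R^o) (-%R : R^o -> R^o) 0 by exact: mdiff_opp.
have Topp : tangent_map (id_chart R^o) (id_chart R^o) (-%R : R^o -> R^o) 0 1 = -1.
  exact: tangent_map_opp.
have dcopp : mdiff (id_chart R^o) c1 (c \o -%R) 0.
  by apply: (mdiff_comp idRP idRP dopp); rewrite oppr0.
have de : mdiff (id_chart R^o) c1 e 0.
  apply: (mdiff_mul (L := L) idRP (c' := c1) (c'' := c1)) => //.
  by rewrite oppr0 c0 c'0 mulg1.
(* The velocities at [0] of [c \o -%R] and [c'] are [- xi] and [xi], and they cancel. *)
have Te : tangent_map (id_chart R^o) c1 e 0 1 = 0.
  rewrite (tangent_map_mul (L := L) (F := c \o -%R) (1 : R^o) idRP dcopp dc') //=;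
    last by rewrite oppr0.
  have dcN : mdiff (id_chart R^o) c1 c (- 0) by rewrite oppr0.
  rewrite Tc' (tangent_map_comp idRP idRP dopp dcN) /= Topp oppr0.
  by rewrite [X in X + _]linearN [X in - X]Tc addNr.
have Te0 w : tangent_map (id_chart R^o) c1 e 0 w = 0.
  rewrite [w](_ : _ = w *: (1 : R^o)); last by rewrite /GRing.scale /= mulr1.
  transitivity (w *: tangent_map (id_chart R^o) c1 e 0 1); first exact: linearZ_LR.
  by rewrite Te scaler0.
have ce t : {for t, continuous e}.
  apply: (continuous_mul (F := c \o -%R)); last exact: cc'.
  by apply: continuous_comp; [exact: opp_continuous|exact: cc].
(* Constancy is proved for the coordinates [c1 \o e], hence only for those [t] at which [e] is known
   to stay in the domain of [c1]. *)
have [d d0 de1] : exists2 d : R, 0 < d & forall t, `|t| < d -> chart_dom c1 (e t).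
  have := open_nbhs_nbhs (conj (chart_open_dom c1P) c1_1).
  rewrite -e0 => /(ce 0) /nbhs_ballP [d d0 de1]; exists d => // t td.
  by apply: de1; rewrite /ball /= sub0r normrN.
have de' t : `|t| < d ->
    differentiable (c1 \o e) (t : R^o) /\ 'd (c1 \o e) (t : R^o) 1 = 0.
  move=> /de1 c1e.
  pose sh := fun s : R^o => s - t : R^o.
  have dsh : mdiff (id_chart R^o) (id_chart R^o) sh t.
    by split => //; apply: cvgB; [exact: cvg_id|exact: cvg_cst].
  have sht : sh t = 0 by rewrite /sh subrr.
  have de0 : mdiff (id_chart R^o) c1 e (sh t) by rewrite sht.
  have dlr : mdiff c1 c1 (fun x => c (- t) * x * c' t)%g (e (sh t)).
    by apply: (mdiff_lrmul (L := L)); rewrite ?sht ?e0 // mulg1.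
  have dl := mdiff_comp idRP c1P de0 dlr.
  have eE : e = ((fun x => c (- t) * x * c' t)%g \o e) \o sh.
    by apply/funext => s /=; rewrite -[in c' t](opprK t) -eD /sh opprK subrK.
  rewrite eE; split; first by case: (mdiff_comp idRP idRP dsh dl).
  have := congr1 (@^~ (1 : R^o)) (tangent_map_comp idRP idRP dsh dl).
  rewrite /= (tangent_map_comp idRP c1P de0 dlr) /= sht Te0.
  by move=> Tt; exact: etrans Tt (linear0 _).
have [r [k [r0 rd rk]]] : exists r : R, exists k, [/\ 0 <= r, r < d & r *+ k.+1 = 1].
  have [k _ /(_ k (leqnn k)) kd] := near_infty_natSinv_lt (PosNum d0).
  exists k.+1%:R^-1, k; split; [by rewrite invr_ge0|exact: kd|].
  by rewrite -[LHS]mulr_natr mulVf // pnatr_eq0.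
have /(congr1 (chart_inv c1)) : (c1 \o e) r = (c1 \o e) 0.
  apply: (@constant_of_diff0 R m (c1 \o e) r r0) => t /andP[t0 tr].
  by apply: de'; rewrite ger0_norm // (le_lt_trans tr).
rewrite /= !(chartK c1P) ?e0 //; last by apply: de1; rewrite ger0_norm.
move=> er.
have cr : c r = c' r.
  by apply: (mulgI (c (- r))); rewrite -[RHS]/(e r) er -cD addNr c0.
by rewrite -rk (one_parameterMn _ _ cP) (one_parameterMn _ _ c'P) cr.
Qed.

Lemma lie_exp_Ad a xi : lie_exp L (Ad L a xi) = (a * lie_exp L xi * a^-1)%g.
Proof.
(* By uniqueness, the subgroup picked by [xget] has the same value at [1] as any other. *)
have expE v c : one_parameter_subgroup L v c -> lie_exp L v = c 1.
  move=> cP; rewrite /lie_exp; case: xgetP => [x _ [c' c'P <-]|/(_ (c 1))].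
    exact: one_parameter_unique c'P cP.
  by case; exists c.
have [[c cP]|noc] := pselect (exists c, one_parameter_subgroup L xi c).
  by rewrite (expE _ _ cP) (expE _ _ (one_parameter_conj a cP)).
have exp1 v : ~ (exists c, one_parameter_subgroup L v c) -> lie_exp L v = 1%g.
  move=> nov; rewrite /lie_exp; case: xgetP => // x _ [c cP _].
  by case: nov; exists c.
(* A subgroup with velocity [Ad L a xi] would conjugate back by [a^-1] to one with velocity [xi]. So
   both exponentials are the default [1], which conjugation fixes. *)
rewrite !exp1 ?mulg1 ?mulgV // => -[c cP]; apply: noc.
exists (fun t => a^-1 * c t * (a^-1)^-1)%g.
by have := one_parameter_conj a^-1%g cP; rewrite AdK.
Qed.

End OneParameter.

(** * Isotropy algebras and the vanishing of node forces *)

Section Isotropy.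
Context {R : realType} {m n : nat} {G : topGroupType} {Q : topologicalType}.
Context (L : lie_group (R := R) m G) (X : manifold (R := R) n Q).
Context (act : G -> Q -> Q).

(** The exponential of [t *: Ad L a rho] is the conjugate by [a] of that of [t *: rho]; since the
    latter fixes [q], the former fixes [act a q]. *)
Lemma lie_algebra_isotropy_Ad (a : G) (q : Q) (rho : 'rV[R]_m) :
  smooth_action L X act -> lie_algebra L (isotropy act q) rho ->
  lie_algebra L (isotropy act (act a q)) (Ad L a rho).
Proof.
move=> actP rhoq t; rewrite -AdZ lie_exp_Ad /isotropy /=.
by rewrite -(actM actP) mulgVK (actM actP) rhoq.
Qed.

(** The curve defining the infinitesimal generator is constantly [q], so its velocity is zero. *)
Lemma momentum_map_isotropy (q : Q) (alpha : 'Hom('rV[R]_n, R^o)) (rho : 'rV[R]_m) :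
  lie_algebra L (isotropy act q) rho -> momentum_map L X act q alpha rho = 0.
Proof.
move=> rhoq; rewrite /momentum_map /inf_generator.
rewrite (_ : (fun _ => _) = cst (chart_at X q q)) ?derive_cst ?linear0 //.
by apply/funext => t; rewrite rhoq.
Qed.

Lemma node_force_isotropy (d : Q -> Q -> R) sigma (q y : Q) (rho : 'rV[R]_m) :
  lie_algebra L (isotropy act q) rho -> node_force L X act d sigma q y rho = 0.
Proof.
by move=> rhoq; rewrite /node_force; case: ifP => _;
  rewrite momentum_map_isotropy // mulr0.
Qed.

End Isotropy.

(** * The left-trivialized differential of [tau] and its inverse *)

Section TrivializedDifferential.
Context {R : realType} {m : nat} {G : topGroupType} (L : lie_group (R := R) m G).
Variables (U : set 'rV[R]_m) (tau : 'rV[R]_m -> G).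
Hypothesis tauP : analytic_diffeo L U tau.
Implicit Types xi v : 'rV[R]_m.

Let idV := id_chart 'rV[R]_m.
Let c1 := chart_at L 1%g.

Let chart_atP p : is_chart (chart_at L p).
Proof. exact: (atlas_chart (atlasP L) (chart_at_atlas L p)). Qed.

Let idVP : is_chart idV. Proof. exact: id_chartP. Qed.

(** [tau] is analytic with respect to the atlas [A], while [Dtau] uses charts of [atlas L]. The
    union of the two is a smooth atlas, which supplies the change of chart. *)
Lemma mdiff_analytic_diffeo xi : U xi -> mdiff idV (chart_at L (tau xi)) tau xi.
Proof.
move=> Uxi; have [_ _ _ [A [[AP _ _] ALP tauA _]]] := tauP.
have [c Ac cxi] := atlas_cover AP (tau xi).
have dtau : mdiff idV c tau xi by apply: (mdiff_mfd_map tauA).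
have dt : mdiff c (chart_at L (tau xi)) id (tau xi).
  apply: (mdiff_transition ALP) => //; [by left| |exact: mem_chart_at].
  by right; exact: chart_at_atlas.
exact: (mdiff_comp idVP (atlas_chart AP Ac) dtau dt).
Qed.

Lemma mdiff_analytic_diffeo_inv xi : U xi ->
  mdiff (chart_at L (tau xi)) idV ('pinv_(fun=> 0) U tau) (tau xi).
Proof.
move=> Uxi; have [_ _ _ [A [[AP _ _] ALP _ tauA]]] := tauP.
have [c Ac cxi] := atlas_cover AP (tau xi).
have dt : mdiff (chart_at L (tau xi)) c id (tau xi).
  apply: (mdiff_transition ALP) => //; [|by left|exact: mem_chart_at].
  by right; exact: chart_at_atlas.
have dpinv : mdiff c idV ('pinv_(fun=> 0) U tau) (tau xi).
  by apply: (mdiff_mfd_map tauA) => //; exists xi.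
exact: (mdiff_comp (chart_atP _) (atlas_chart AP Ac) dt dpinv).
Qed.

Let mdiff_lmul a p : mdiff (chart_at L p) (chart_at L (a * p)%g) (fun x => a * x)%g p.
Proof.
rewrite (_ : (fun x => a * x)%g = (fun x => a * x * 1)%g); last first.
  by apply/funext => x; rewrite mulg1.
apply: (mdiff_lrmul (L := L)); try exact: chart_at_atlas.
  exact: mem_chart_at.
by rewrite mulg1; exact: mem_chart_at.
Qed.

Let mdiff_left xi : U xi -> mdiff idV c1 (fun y => (tau xi)^-1 * tau y)%g xi.
Proof.
move=> Uxi; have := mdiff_lmul (tau xi)^-1%g (tau xi); rewrite mulVg => dl.
exact: (mdiff_comp idVP (chart_atP _) (mdiff_analytic_diffeo Uxi) dl).
Qed.

(** The chain rule merges the two tangent maps in [Dtau] into that of one map with value [1] at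
    [xi], the form in which [tangent_map_mul] applies. *)
Lemma DtauE xi v : U xi ->
  Dtau L tau xi v = tangent_map idV c1 (fun y => (tau xi)^-1 * tau y)%g xi v.
Proof.
move=> Uxi; have := mdiff_lmul (tau xi)^-1%g (tau xi); rewrite mulVg => dl.
have := tangent_map_comp idVP (chart_atP _) (mdiff_analytic_diffeo Uxi) dl.
rewrite [X in tangent_map _ _ X](_ : _ = (fun y => (tau xi)^-1 * tau y)%g) // => ->.
by rewrite /Dtau lfunE.
Qed.

(* Differentiate [w1 y * w2 y = 1] in [y] at [xi], where
   [w1 y = tau xi * ((tau xi)^-1 * tau y) * (tau xi)^-1] and
   [w2 y = (tau (- xi))^-1 * tau (- y)]. *)
Lemma Ad_Dtau xi v : (forall y, (tau y * tau (- y))%g = 1%g) -> U xi -> U (- xi) ->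
  Ad L (tau xi) (Dtau L tau xi v) = Dtau L tau (- xi) v.
Proof.
move=> tauN Uxi UNxi.
apply: etrans (congr1 (Ad L (tau xi)) (DtauE v Uxi)) _.
apply/esym; apply: etrans (DtauE v UNxi) _; apply/esym.
have tauV : (tau (- xi))^-1%g = tau xi.
  by have := tauN (- xi); rewrite opprK => /mulg1_eq.
have c11 : chart_dom c1 1%g by exact: mem_chart_at.
pose w y := ((tau xi)^-1 * tau y)%g.
pose w' y := ((tau (- xi))^-1 * tau y)%g.
have dw : mdiff idV c1 w xi by exact: mdiff_left.
have dw' : mdiff idV c1 w' (- xi) by exact: mdiff_left.
have w1 : w xi = 1%g by rewrite /w mulVg.
have w'1 : w' (- xi) = 1%g by rewrite /w' mulVg.
have dconj : mdiff c1 c1 (fun x => tau xi * x * (tau xi)^-1)%g (w xi).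
  apply: (mdiff_lrmul (L := L)); rewrite ?w1 ?mulg1 ?mulgV //; exact: chart_at_atlas.
have dopp : mdiff idV idV -%R xi by exact: mdiff_opp.
have du := mdiff_comp idVP (chart_atP _) dw dconj.
have dv := mdiff_comp idVP idVP dopp dw'.
have := tangent_map_mul (L := L) v idVP du dv.
(* The last factor [(tau xi)^-1] of the conjugate cancels the first factor
   [(tau (- xi))^-1 = tau xi] of [w'], which leaves [tau y * tau (- y)]. *)
rewrite (_ : (fun y : 'rV[R]_m => _) = (fun=> 1%g)); last first.
  by apply/funext => y; rewrite /w /w' /= mulVKg tauV mulgA mulgVK tauN.
rewrite tangent_map_cst /= w1 mulg1 mulgV w'1 => /(_ erefl erefl).
have := congr1 (@^~ v) (tangent_map_comp idVP (chart_atP _) dw dconj).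
rewrite /= w1 => ->.
have := congr1 (@^~ v) (tangent_map_comp idVP idVP dopp dw').
move=> /= ->.
have -> : tangent_map idV idV -%R xi v = - v.
  exact: tangent_map_opp.
rewrite [X in _ + X]linearN => /esym /eqP.
by rewrite subr_eq0 => /eqP.
Qed.

(** Near [xi], translating by [tau xi] and then applying the local inverse of [tau] undoes
    [y |-> (tau xi)^-1 * tau y]. Its tangent map at [1] is therefore a left inverse of
    [Dtau L tau xi]. *)
Lemma Dtau_inj xi : U xi -> injective (Dtau L tau xi).
Proof.
move=> Uxi; have [oU _ tau_inj _] := tauP.
pose w y := ((tau xi)^-1 * tau y)%g.
have dw : mdiff idV c1 w xi by exact: mdiff_left.
have w1 : w xi = 1%g by rewrite /w mulVg.
have dl : mdiff c1 (chart_at L (tau xi)) (fun x => tau xi * x)%g (w xi).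
  by have := mdiff_lmul (tau xi) 1%g; rewrite w1 mulg1.
have dpinv : mdiff (chart_at L (tau xi)) idV ('pinv_(fun=> 0) U tau) (tau xi * w xi)%g.
  by rewrite w1 mulg1; exact: mdiff_analytic_diffeo_inv.
have dp := mdiff_comp (chart_atP _) (chart_atP _) dl dpinv.
have Tcomp := tangent_map_comp idVP (chart_atP _) dw dp.
apply: (can_inj (g := tangent_map c1 idV
  ('pinv_(fun=> 0) U tau \o (fun x => tau xi * x)%g) (w xi))) => v.
rewrite (DtauE v Uxi) -[LHS](congr1 (@^~ v) Tcomp) /tangent_map.
rewrite (@near_eq_diff _ _ _ id) ?diff_val //.
have := open_nbhs_nbhs (conj oU Uxi).
by apply: filterS => y Uy /=; rewrite mulVKg pinvKV // inE.
Qed.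

(** An injective endomorphism of a finite-dimensional space is bijective, so [Dtau_inv] is also a
    right inverse. *)
Lemma Dtau_invK xi v : U xi -> Dtau L tau xi (Dtau_inv L tau xi v) = v.
Proof.
move=> Uxi; have /lker0P/lker0_compfV/lfunP/(_ v) := Dtau_inj Uxi.
by rewrite comp_lfunE id_lfunE.
Qed.

(** After applying the injective map [Ad L (tau xi)], [Ad_Dtau] turns the left side into [Dtau] at
    [- xi] following its own inverse. For [xi = h *: xi0 k], this evaluates the transport in (D4)
    and (D5) on [Ad L (tau xi) v]. *)
Lemma Dtau_Dtau_inv_Ad xi v :
  (forall y, (tau y * tau (- y))%g = 1%g) -> U xi -> U (- xi) ->
  Dtau L tau xi (Dtau_inv L tau (- xi) (Ad L (tau xi) v)) = v.
Proof.
move=> tauN Uxi UNxi; apply: (can_inj (AdK L (tau xi))).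
by rewrite Ad_Dtau // Dtau_invK.
Qed.

End TrivializedDifferential.

(** * Backward propagation along the discrete path *)

Theorem corollary4p4 (R : realType) (m n : nat)
    (G : topGroupType) (Q : topologicalType)
    (L : lie_group (R := R) m G) (X : manifold (R := R) n Q)
    (act : G -> Q -> Q) (act_smooth : smooth_action L X act)
    (d : Q -> Q -> R) (d_dist : is_distance d)
    (sigma h : R) (sigma_gt0 : 0 < sigma) (h_gt0 : 0 < h)
    (N p : nat) (N_ge1 : (1 <= N)%N)
    (nd : nat -> nat) (nd0 : nd 0%N = 0%N) (ndp : nd p = N)
    (nd_incr : forall i, (i < p)%N -> (nd i < nd i.+1)%N)
    (Q0 : Q) (Qt : nat -> Q)
    (l : 'rV[R]_m * 'rV[R]_m -> R^o) (l_smooth : smooth_on setT l)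
    (tau : 'rV[R]_m -> G) (U : set 'rV[R]_m)
    (U0 : U 0) (tau_diffeo : analytic_diffeo L U tau)
    (tau0 : tau 0 = 1%g) (tauN : forall xi, (tau xi * tau (- xi))%g = 1%g)
    (xi00 : 'rV[R]_m)
    (g : nat -> G) (xi0 xi1 : nat -> 'rV[R]_m)
    (muc mu0 mu1 : nat -> 'Hom('rV[R]_m, R^o))
    (xi_U : forall k, (k < N)%N -> U (h *: xi0 k) /\ U (- (h *: xi0 k)))
    (d_diff : forall i, (1 <= i <= p)%N -> diff1_dist X d (act (g (nd i)) Q0) (Qt i))
    (sol : discrete_EL L X act d tau U l sigma h N p nd Q0 Qt xi00
             g xi0 xi1 muc mu0 mu1) :
  forall k, (k <= N)%N ->
  forall rho, lie_algebra L (isotropy act (act (g k) Q0)) rho -> mu0 k rho = 0.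
Proof.
have [g0E _ _ _ _ D1 _ _ D4 D5 D6 _] := sol.
pose g_k_isotropy k := lie_algebra L (isotropy act (act (g k) Q0)).
have mu0_step k : (k < N)%N ->
    (forall rho, g_k_isotropy k.+1 rho -> mu0 k.+1 rho = 0) ->
    forall rho, g_k_isotropy k rho -> mu0 k rho = 0.
  move=> kN IH rho rhok; have [Uk UNk] := xi_U k kN.
  (* Replacing [0] by the next momentum at the transported vector reduces the goal to the equality
     of two consecutive pairings. *)
  have := IH (Ad L (tau (h *: xi0 k)) rho).
  have [gk _ _] := D1 k kN; rewrite /g_k_isotropy gk (actM act_smooth).
  move=> /(_ (lie_algebra_isotropy_Ad _ act_smooth rhok)) <-.
  have [[i [ip ki]]|nonode] := pselect (exists i, (1 <= i <= p)%N /\ k = nd i).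
    (* The last node is excluded because [nd p = N] while [k < N], so (D5) applies. *)
    have ip' : (1 <= i < p)%N.
      case/andP: ip => -> /=; rewrite leq_eqVlt => /orP[/eqP ipE|//].
      by move: kN; rewrite ki ipE ndp ltnn.
    rewrite (D5 i k ip' ki) (Dtau_Dtau_inv_Ad tau_diffeo) //.
    by rewrite node_force_isotropy // addr0.
  rewrite D4 //; last by move=> i ip ki; apply: nonode; exists i.
  by rewrite /dual !comp_lfunE (Dtau_Dtau_inv_Ad tau_diffeo).
(* Induction on the distance [N - k] to the final index, where (D6) leaves only a node force that
   vanishes on the isotropy algebra. *)
move=> k kN; rewrite -(subKn kN); elim: (N - k)%N (leq_subr k N) => [|j IH] jN rho.
  by rewrite subn0 => rhoN; have := D6 rho; rewrite node_force_isotropy // addr0.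
have jN' : (N - j.+1 < N)%N by rewrite ltn_subrL (leq_trans _ jN).
(* Since [j.+1 <= N], the truncated subtraction is exact and the successor of [N - j.+1] is
   [N - j]. *)
apply: mu0_step => //; rewrite -subSn // subSS.
by apply: IH; exact: ltnW.
Qed.
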